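(* Let $G$ be a finite group and let $A\trianglelefteq G$ be an abelian normal subgroup such that $G/A$ is cyclic of order $\omega$. Choose $t\in G$ whose image generates $G/A$, and set $$F:=C_A(t)=A\cap Z(G),\qquad f:=|F|,\qquad n:=|A|.$$ Assume that $C_A(t^j)=F$ for all $1\le j\le \omega-1$. Then for every $r\ge 1$, $$|\mathrm{Comm}_r(G)|=n^r+(\omega^r-1)\,n\,f^{\,r-1}.$$ Equivalently, for every $r\ge 1$, $$P_r(G)=\frac{1}{\omega^r}+\left(1-\frac{1}{\omega^r}\right)\left(\frac{f}{n}\right)^{r-1}.$$ In particular, for $r=3$, $$P_3(G)=\frac{1}{\omega^3}+\left(1-\frac{1}{\omega^3}\right)\left(\frac{f}{n}\right)^2 .$$
   Context: For a finite group $G$ and $r\ge 1$, $\mathrm{Comm}_r(G):=\{(x_1,\dots,x_r)\in G^r : x_ix_j=x_jx_i\ \text{for all } i,j\}$ and $P_r(G):=|\mathrm{Comm}_r(G)|/|G|^r$. $Z(G)$ is the center of $G$, and for $x\in G$, $C_A(x)=\{a\in A: ax=xa\}$. *)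

(* Defs.v *)
From mathcomp Require Import all_boot all_order all_fingroup all_algebra all_solvable.

Set Implicit Arguments.
Unset Strict Implicit.
Unset Printing Implicit Defensive.

Import GroupScope.

Definition Comm (gT : finGroupType) (r : nat) (G : {set gT}) : {set r.-tuple gT} :=
  [set x : r.-tuple gT |
    [forall i, tnth x i \in G] &&
    [forall i, forall j, tnth x i * tnth x j == tnth x j * tnth x i]].

Definition commProb (gT : finGroupType) (r : nat) (G : {set gT}) : rat :=
  (#|Comm r G|%:R / #|G|%:R ^+ r)%R.

(* Main.v *)
Require Import Defs.
From mathcomp Require Import all_boot all_order all_fingroup all_algebra all_solvable.
From mathcomp Require Import ring zify.

Set Implicit Arguments.
Unset Strict Implicit.
Unset Printing Implicit Defensive.

Import GroupScope.

(** The count is a partition argument.  Put omega = |G : A| and f = |F|.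

    Every x in G outside A is a * t ^+ j with a in A and 0 < j < omega, so
    C_A(x) = C_A(t ^+ j) = F.  As F is central and C_G(x) / F embeds in the
    cyclic group G / A, the group C_G(x) is abelian ([abelian_cent1]).  Its
    order is omega * f ([card_cent1_outside]): all conjugates of x lie in the
    coset x G', and |G'| <= |A : F| because the commutators [t, a] with a in A
    already exhaust G' ([card_der1_cyclic_ext]), while the conjugates of x
    under A alone number |A : F|.

    If y in C_G(x) lies outside A too, then, both centralizers being abelian,
    C_G(y) = C_G(x) ([cent1_abelian_eq]).  A commuting tuple with an entry
    outside A therefore lies in exactly one of the c groups C_G(x), and each
    of them contains (omega f)^r - f^r such tuples, since C_G(x) meets A in F.
    This gives |Comm_r(G)| = n^r + c ((omega f)^r - f^r), see [card_Comm_CA].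
    The number c comes from the case r = 1, where Comm_1(G) = G:
    c (omega f - f) = n omega - n, so c f = n unless omega = 1. *)

(** * Counting with abelian centralizers *)

Definition tuples_in (T : finType) r (X : {set T}) : {set r.-tuple T} :=
  [set x | [forall i, tnth x i \in X]].

Lemma tuples_inP (T : finType) r (X : {set T}) (x : r.-tuple T) :
  reflect (forall i, tnth x i \in X) (x \in tuples_in r X).
Proof. by rewrite inE; apply: forallP. Qed.

Lemma card_tuples_in (T : finType) r (X : {set T}) :
  #|tuples_in r X| = (#|X| ^ r)%N.
Proof.
rewrite -[in RHS](card_ord r) -card_ffun_on.
have inj_tup : injective (fun f : {ffun 'I_r -> T} => [tuple f i | i < r]).
  move=> f g eq_fg; apply/ffunP=> i.
  by have := congr1 (fun u => tnth u i) eq_fg; rewrite !tnth_mktuple.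
rewrite -(card_imset _ inj_tup); apply: eq_card => x; apply/tuples_inP/imsetP.
  move=> Xx; exists [ffun i => tnth x i].
    by apply/ffun_onP=> i; rewrite ffunE.
  by apply: eq_from_tnth => i; rewrite tnth_mktuple ffunE.
by case=> f /ffun_onP Xf -> i; rewrite tnth_mktuple Xf.
Qed.

Lemma tuples_inI (T : finType) r (X Y : {set T}) :
  tuples_in r (X :&: Y) = tuples_in r X :&: tuples_in r Y.
Proof.
apply/setP=> x; rewrite in_setI; apply/tuples_inP/andP.
  by move=> XYx; split; apply/tuples_inP=> i; have /setIP[] := XYx i.
by case=> /tuples_inP Xx /tuples_inP Yx i; rewrite inE Xx Yx.
Qed.

Lemma card_unique_cover (T I : finType) (D : {set T}) (P : {set I})
    (B : I -> {set T}) :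
  (forall x, x \in D ->
     exists2 i0, i0 \in P & {in P, forall i, (x \in B i) = (i == i0)}) ->
  #|D| = \sum_(i in P) #|D :&: B i|.
Proof.
move=> coverD; under eq_bigr => i _ do rewrite -sum1_card.
under eq_bigr => i _ do under eq_bigl => x do rewrite in_setI.
under eq_bigr => i _ do rewrite big_mkcondr.
rewrite exchange_big /= -sum1_card; apply: eq_bigr => x /coverD[i0 Pi0 Bx].
rewrite (bigD1 i0) //= Bx // eqxx big1 ?addn0 // => i /andP[Pi neq_i].
by rewrite Bx // (negPf neq_i).
Qed.

Lemma CommP (gT : finGroupType) r (G : {set gT}) (x : r.-tuple gT) :
  reflect ((forall i, tnth x i \in G) /\
           (forall i j, commute (tnth x i) (tnth x j)))
          (x \in Comm r G).
Proof.
rewrite inE; apply: (iffP andP) => [[/forallP Gx /forallP cx] | [Gx cx]].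
  by split=> // i j; have /forallP/(_ j)/eqP := cx i.
split; first exact/forallP.
by apply/forallP=> i; apply/forallP=> j; apply/eqP/cx.
Qed.

Lemma tuples_in_Comm (gT : finGroupType) r (G X : {set gT}) :
  abelian X -> X \subset G -> tuples_in r X \subset Comm r G.
Proof.
move=> abX sXG; apply/subsetP=> x /tuples_inP Xx; apply/CommP.
by split=> [i | i j]; [apply: (subsetP sXG) | apply: (centsP abX)].
Qed.

Lemma Comm1 (gT : finGroupType) (G : {set gT}) : Comm 1 G = tuples_in 1 G.
Proof.
apply/setP=> x; apply/CommP/tuples_inP=> [[] // | Gx].
by split=> // i j; rewrite (ord1 i) (ord1 j).
Qed.

(** Both x and y lie in each of the two centralizers; as these are abelian,
    each of them centralizes both elements. *)
Lemma cent1_abelian_eq (gT : finGroupType) (G : {group gT}) x y :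
  x \in G -> abelian 'C_G[x] -> abelian 'C_G[y] -> y \in 'C_G[x] ->
  'C_G[y] = 'C_G[x].
Proof.
move=> Gx abCx abCy Cxy; have [Gy cxy] := setIP Cxy.
have Cyx : x \in 'C_G[y] by rewrite inE Gx cent1C.
apply/eqP; rewrite eqEsubset; apply/andP; split; apply/subsetP=> z Cz.
  rewrite inE (setIP Cz).1; apply/cent1P.
  by apply: (centsP abCy).
by rewrite inE (setIP Cz).1; apply/cent1P; apply: (centsP abCx).
Qed.

(** The sets C_G(x) with x outside A cover the commuting tuples that are not
    tuples of A, each exactly once: the one that contains a given tuple is
    the centralizer of any entry outside A. *)
Lemma card_Comm_CA (gT : finGroupType) r (G A : {group gT}) (F : {set gT}) m :
  A \subset G -> abelian A ->
  {in G :\: A, forall x, abelian 'C_G[x]} ->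
  {in G :\: A, forall x, 'C_A[x] = F} ->
  {in G :\: A, forall x, #|'C_G[x]| = m} ->
  #|Comm r G| =
    (#|A| ^ r + #|[set 'C_G[x] | x in G :\: A]| * (m ^ r - #|F| ^ r))%N.
Proof.
move=> sAG abA abC CA cardC.
have sTC := tuples_in_Comm r abA sAG.
rewrite -(cardsID (tuples_in r A)) (setIidPr sTC) card_tuples_in.
congr (_ + _)%N; pose B (M : {set gT}) := tuples_in r M.
rewrite (@card_unique_cover _ _ _ [set 'C_G[x] | x in G :\: A] B).
  rewrite -sum_nat_const; apply: eq_bigr => _ /imsetP[x GAx ->].
  have -> : (Comm r G :\: tuples_in r A) :&: B 'C_G[x]
             = B 'C_G[x] :\: tuples_in r A.
    rewrite setIDAC (setIidPr _) //.
    by rewrite tuples_in_Comm ?abC ?subsetIl.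
  rewrite cardsD -tuples_inI !card_tuples_in cardC // -(CA x GAx).
  by rewrite setIAC (setIidPr sAG).
move=> x /setDP[/CommP[Gx cx] notAx].
have [i notAxi] : exists i, tnth x i \notin A.
  by apply/existsP; move: notAx; rewrite inE negb_forall.
have GAxi : tnth x i \in G :\: A by rewrite inE notAxi Gx.
exists 'C_G[tnth x i]; first exact: imset_f.
move=> _ /imsetP[y GAy ->]; apply/tuples_inP/eqP=> [Cyx | -> j].
  have /setDP[Gy _] := GAy.
  by rewrite (cent1_abelian_eq Gy (abC y GAy) (abC _ GAxi) (Cyx i)).
by rewrite inE Gx; apply/cent1P/cx.
Qed.

(** * Cyclic extensions of an abelian group *)

Lemma cyclic_ext_mul (gT : finGroupType) (G A : {group gT}) t :
  A <| G -> t \in G -> generator (G / A) (coset A t) -> G :=: A * <[t]>.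
Proof.
move=> /andP[sAG nAG] Gt /eqP gent; apply/eqP; rewrite eqEsubset.
rewrite -quotientSK // quotient_cycle ?(subsetP nAG) // gent subxx /=.
by rewrite mul_subG ?cycle_subG.
Qed.

Lemma cyclic_ext_coset (gT : finGroupType) (G A : {group gT}) t x :
  A <| G -> t \in G -> generator (G / A) (coset A t) -> x \in G :\: A ->
  exists2 j, (1 <= j <= #|G / A| - 1)%N & x \in A :* t ^+ j.
Proof.
move=> /andP[sAG nAG] Gt /eqP genGA /setDP[Gx notAx].
have nAt := subsetP nAG _ Gt; have nAx := subsetP nAG _ Gx.
have: coset A x \in <[coset A t]> by rewrite -genGA mem_quotient.
case/cyclePmin=> j lt_j def_x; exists j; last first.
  by apply/rcoset_kercosetP; rewrite ?groupX // morphX.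
have j_gt0 : (0 < j)%N.
  rewrite lt0n; apply: contraNneq notAx => j0.
  by apply: coset_idr => //; rewrite def_x j0.
by rewrite genGA -orderE; lia.
Qed.

(** The map a |-> [t, a] is an endomorphism of A with kernel C_A(t).  Its
    image S is normalized by A and by t, and modulo S the elements of A
    commute with t, so the quotient by S is abelian and S contains G'. *)
Lemma card_der1_cyclic_ext (gT : finGroupType) (G A : {group gT}) t :
  abelian A -> t \in 'N(A) -> G :=: A * <[t]> ->
  (#|G^`(1)| <= #|A : 'C_A[t]|)%N.
Proof.
move=> abA nAt defG.
have Acomm a : a \in A -> [~ t, a] \in A.
  by move=> Aa; rewrite commgEr groupM // memJ_norm ?groupV.
pose S : {set gT} := [set [~ t, a] | a in A].
have S_group : group_set S.
  apply/group_setP; split=> [|_ _ /imsetP[a Aa ->] /imsetP[b Ab ->]].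
    by apply/imsetP; exists 1; rewrite // commg1.
  apply/imsetP; exists (b * a); first exact: groupM.
  by rewrite commgMJ conjgE (centsP abA _ (Acomm b Ab) a Aa) mulKg.
pose SG := Group S_group.
have sSA : S \subset A by apply/subsetP=> _ /imsetP[a Aa ->]; apply: Acomm.
have nSA : A \subset 'N(SG) by apply: sub_abelian_norm abA sSA.
have nSt : t \in 'N(SG).
  rewrite inE; apply/subsetP=> _ /imsetP[_ /imsetP[a Aa ->] ->].
  apply/imsetP; exists (a ^ t); first by rewrite memJ_norm.
  by rewrite conjRg [t ^ t]conjgE mulKg.
have nSG : G \subset 'N(SG) by rewrite defG mul_subG ?cycle_subG.
have abGS : abelian (G / SG).
  rewrite defG quotientMl // abelianM !quotient_abelian ?cycle_abelian //.
  rewrite /= (quotient_cycle nSt) cycle_subG.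
  apply/centP=> _ /morphimP[a nSa Aa ->].
  apply/commgP; rewrite -morphR //=; apply/eqP/coset_id.
  by apply/imsetP; exists a.
apply: leq_trans (subset_leq_card (der1_min nSG abGS)) _.
rewrite index_cent1 -(card_lcoset (t ^: A) t^-1); apply: subset_leq_card.
apply/subsetP=> _ /imsetP[a Aa ->].
by rewrite mem_lcoset invgK -conjg_mulR; apply/imsetP; exists a.
Qed.

(** The class of x lies in x G', whose order is at most |A : C_A(t)|; this is
    also the number of A-conjugates of x, so the class has exactly that
    order. *)
Lemma card_cent1_outside (gT : finGroupType) (G A : {group gT}) t x :
  A <| G -> abelian A -> G :=: A * <[t]> -> x \in G ->
  'C_A[x] = 'C_A[t] -> #|'C_G[x]| = (#|G / A| * #|'C_A[t]|)%N.
Proof.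
move=> /andP[sAG nAG] abA defG Gx eqC.
have Gt : t \in G by rewrite defG (subsetP (mulG_subr _ _)) ?cycle_id.
have idx : #|G : 'C_G[x]| = #|A : 'C_A[t]|.
  apply/eqP; rewrite eqn_leq; apply/andP; split; last first.
    by rewrite -eqC !index_cent1 subset_leq_card // imsetS.
  apply: leq_trans (card_der1_cyclic_ext abA (subsetP nAG t Gt) defG).
  rewrite index_cent1 -(card_lcoset (x ^: G) x^-1); apply: subset_leq_card.
  apply/subsetP=> y; rewrite mem_lcoset invgK => /imsetP[g Gg def_xg].
  by rewrite -(mulKg x y) def_xg mem_commg.
have := Lagrange (subsetIl G 'C[x]).
rewrite idx -(Lagrange sAG) -(Lagrange (subsetIl A 'C[t])) card_quotient //.
rewrite mulnAC => /eqP; rewrite eqn_pmul2r ?indexg_gt0 // => /eqP->.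
exact: mulnC.
Qed.

(** C_A(x) = A :&: C_G(x) is central in C_G(x), and the quotient embeds in
    G / A. *)
Lemma abelian_cent1 (gT : finGroupType) (G A : {group gT}) x :
  A <| G -> cyclic (G / A) -> 'C_A[x] \subset 'Z(G) -> abelian 'C_G[x].
Proof.
move=> /andP[sAG nAG] cycGA sCZ.
have defC : A :&: 'C_G[x] = 'C_A[x] by rewrite setIA (setIidPl sAG).
apply: (@cyclic_factor_abelian _ (A :&: 'C_G[x])%G) => /=.
  rewrite subsetI subsetIr /= defC.
  by rewrite (subset_trans sCZ) // subIset // centS ?orbT ?subsetIl.
have nAC : 'C_G[x] \subset 'N(A) by rewrite subIset ?nAG.
rewrite (isog_cyclic (second_isog nAC)).
by apply: cyclicS cycGA; rewrite quotientS ?subsetIl.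
Qed.

Lemma cent1_cyclic_ext (gT : finGroupType) (G A : {group gT}) t :
  A <| G -> abelian A -> G :=: A * <[t]> -> 'C_A[t] = A :&: 'Z(G).
Proof.
move=> /andP[sAG _] abA defG; rewrite setIA (setIidPl sAG) defG centM.
by rewrite cent_cycle setIA (setIidPl abA).
Qed.

(** * The formula *)

(** With c the number of centralizers, the hypothesis on c is the count of the
    elements outside A.  It gives c f = n when omega > 1; when omega = 1 it
    says nothing about c, but then both sides vanish. *)
Lemma outside_count_arith (c f n omega r : nat) :
  (0 < omega)%N -> (0 < r)%N ->
  (c * (omega * f - f) = n * omega - n)%N ->
  (c * ((omega * f) ^ r - f ^ r) = (omega ^ r - 1) * n * f ^ (r - 1))%N.
Proof.
case: r => // r w_gt0 _ count_outside; rewrite subSS subn0 expnMn.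
rewrite -[X in (_ - X)%N]mul1n -mulnBl.
have [-> | w_neq1] := eqVneq omega 1%N; first by rewrite exp1n subnn !muln0.
have <- : (c * f = n)%N by nia.
by rewrite [(f ^ _)%N]expnS mulnCA !mulnA.
Qed.

Lemma commProb_arith (n f omega r : nat) :
  (0 < n)%N -> (0 < omega)%N -> (1 <= r)%N ->
  ((n ^ r + (omega ^ r - 1) * n * f ^ (r - 1))%:R / (n * omega)%:R ^+ r
   = 1 / omega%:R ^+ r
     + (1 - 1 / omega%:R ^+ r) * (f%:R / n%:R) ^+ (r - 1)%N :> rat)%R.
Proof.
case: r => // r n_gt0 w_gt0 _; rewrite subSS subn0.
rewrite GRing.natrD !GRing.natrM GRing.natrB ?expn_gt0 ?w_gt0 // !GRing.natrX.
rewrite GRing.exprMn GRing.expr_div_n [(n%:R ^+ r.+1)%R]GRing.exprS.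
have n0 : (n%:R != 0 :> rat)%R by rewrite Num.Theory.pnatr_eq0 -lt0n.
have w0 : (omega%:R != 0 :> rat)%R by rewrite Num.Theory.pnatr_eq0 -lt0n.
have nX0 : (n%:R ^+ r != 0 :> rat)%R by rewrite GRing.expf_neq0.
have wX0 : (omega%:R ^+ r.+1 != 0 :> rat)%R by rewrite GRing.expf_neq0.
set u := (n%:R ^+ r)%R in nX0 *; set v := (omega%:R ^+ r.+1)%R in wX0 *.
by field; rewrite n0 nX0 wX0.
Qed.

Theorem theorem4p13 (gT : finGroupType) (G A : {group gT}) (t : gT) :
  A <| G -> abelian A -> cyclic (G / A) ->
  t \in G -> generator (G / A) (coset A t) ->
  let F := 'C_A[t] in
  let f := #|F| in
  let n := #|A| in
  let omega := #|G / A| in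
  (forall j : nat, (1 <= j <= omega - 1)%N -> 'C_A[t ^+ j] = F) ->
  [/\ F = A :&: 'Z(G),
      forall r : nat, (1 <= r)%N ->
        #|Comm r G| = (n ^ r + (omega ^ r - 1) * n * f ^ (r - 1))%N,
      forall r : nat, (1 <= r)%N ->
        commProb r G =
          (1 / omega%:R ^+ r
           + (1 - 1 / omega%:R ^+ r) * (f%:R / n%:R) ^+ (r - 1)%N)%R
    & commProb 3 G =
        (1 / omega%:R ^+ 3 + (1 - 1 / omega%:R ^+ 3) * (f%:R / n%:R) ^+ 2)%R].
Proof.
move=> nsAG abA cycGA Gt gent F f n omega CAt.
have [sAG _] := andP nsAG.
have defG := cyclic_ext_mul nsAG Gt gent.
have defF : F = A :&: 'Z(G) := cent1_cyclic_ext nsAG abA defG.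
have CA : {in G :\: A, forall x, 'C_A[x] = F}.
  move=> x GAx.
  have [j j_in /rcosetP[a Aa ->]] := cyclic_ext_coset nsAG Gt gent GAx.
  rewrite -(CAt j j_in); apply/setP=> b; rewrite !in_setI.
  case Ab: (b \in A) => //=; rewrite cent1C [in RHS]cent1C.
  by rewrite groupMl //; apply/cent1P/(centsP abA).
have abC : {in G :\: A, forall x, abelian 'C_G[x]}.
  move=> x GAx; apply: (abelian_cent1 nsAG cycGA).
  by rewrite CA // defF subsetIr.
have cardC : {in G :\: A, forall x, #|'C_G[x]| = (omega * f)%N}.
  move=> x GAx; apply: card_cent1_outside => //; last exact: CA.
  by have /setDP[] := GAx.
have cardComm r := card_Comm_CA r sAG abA abC CA cardC.
have cardG : #|G| = (n * omega)%N.
  by rewrite -(Lagrange sAG) /omega card_quotient ?normal_norm.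
have w_gt0 : (0 < omega)%N by apply: cardG_gt0.
have n_gt0 : (0 < n)%N by apply: cardG_gt0.
have countP r : (1 <= r)%N ->
    #|Comm r G| = (n ^ r + (omega ^ r - 1) * n * f ^ (r - 1))%N.
  move=> r_gt0; rewrite cardComm; congr (_ + _)%N.
  apply: outside_count_arith => //.
  (* The number of centralizers is read off from the case r = 1. *)
  have := cardComm 1%N; rewrite Comm1 card_tuples_in !expn1 cardG => ->.
  by rewrite addKn.
have probP r : (1 <= r)%N ->
    (commProb r G = 1 / omega%:R ^+ r
       + (1 - 1 / omega%:R ^+ r) * (f%:R / n%:R) ^+ (r - 1)%N)%R.
  by move=> r_gt0; rewrite /commProb countP // cardG commProb_arith.
by split=> //; apply: probP.
Qed.
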